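(* If $V$ is a real operator system and $J\subseteq V$ is a kernel in $V$, then $(V/J)_c\cong V_c/J_c$ (canonically, as complex operator systems), where $J_c=J+iJ\subseteq V_c$.
   Context: A real operator system is a unital selfadjoint real subspace of $B(H)$, $H$ a real Hilbert space, with its matrix cones $M_n(V)^+$ and unit $e$ (up to unital complete order isomorphism). Its complexification $V_c=V+iV$ is the complex operator system with $(x+iy)^*=x^*-iy^*$, unit $e$, and $M_n(V_c)^+=\{x+iy: x=x^*,\,y=-y^*\in M_n(V),\ \begin{bmatrix} x & -y \\ y & x \end{bmatrix}\in M_{2n}(V)^+\}$. A map is ucp if it is linear, unital and completely positive (selfadjoint and positive at every matrix level). A kernel in a (real or complex) operator system $V$ is a subspace of the form $J={\rm Ker}(\varphi)$ for a ucp map $\varphi$ from $V$ into an operator system; if $J$ is a kernel in a real operator system $V$ then $J_c$ is a kernel in $V_c$. For a kernel $J$, the quotient operator system $V/J$ is the vector space $V/J$ with unit $e+J$ and the unique matrix ordering making it an operator system such that the quotient map $q:V\to V/J$ is ucp and every ucp map $\varphi:V\to W$ into an operator system with $J\subseteq{\rm Ker}(\varphi)$ factors as $\varphi=\tilde\varphi\circ q$ for a unique ucp map $\tilde\varphi:V/J\to W$. Equivalently, for selfadjoint $x$, $x+M_n(J)\ge 0$ iff for every $\epsilon>0$ there is $y\in M_n(J)$ with $x+y+\epsilon\, I_n\otimes e\ge 0$. *)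

(* Defs.v *)
From HB Require Import structures.
From mathcomp Require Import all_boot all_order all_algebra.
From mathcomp Require Import reals ring lra.
From mathcomp Require Import complex ring_quotient generic_quotient.

Set Implicit Arguments.
Unset Strict Implicit.
Unset Printing Implicit Defensive.

Import Order.TTheory GRing.Theory Num.Theory.
Local Open Scope ring_scope.
Local Open Scope quotient_scope.
Local Open Scope complex_scope.

(** The real and the complex theory are developed together, over a field of
    scalars [K] with a conjugation [theta]: [(R, idfun)] gives the real case and
    [(R[i], conjc)] the complex one, for [R : realType]. *)

Section Hilbert.
Variables (K : numFieldType) (theta : {rmorphism K -> K}).

Definition cauchy_complete (H : lmodType K) (dot : H -> H -> K) : Prop :=
  forall u : nat -> H,
    (forall eps : K, 0 < eps -> exists N, forall m n, (N <= m)%N -> (N <= n)%N ->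
       dot (u m - u n) (u m - u n) < eps) ->
    exists l : H, forall eps : K, 0 < eps ->
      exists N, forall n, (N <= n)%N -> dot (u n - l) (u n - l) < eps.

(* The inner product is linear in its first argument. *)
Record hilbert := Hilbert {
  hilbert_space :> lmodType K;
  inner : {dot hilbert_space for theta};
  _ : cauchy_complete inner
}.

Variable H : hilbert.

Definition bounded_operator (T : H -> H) : Prop :=
  linear T /\ exists M : K, forall x, inner H (T x) (T x) <= M * inner H x x.

Definition adjoint_operators (S T : H -> H) : Prop :=
  forall x y, inner H (S x) y = inner H x (T y).

(* [H^n] and the action on it of an n x n matrix of operators on [H]. *)
Definition inner_power n (xi eta : 'I_n -> H) : K :=
  \sum_i inner H (xi i) (eta i).

Definition matrix_operator n (T : 'I_n -> 'I_n -> H -> H) (xi : 'I_n -> H)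
    : 'I_n -> H :=
  fun i => \sum_j T i j (xi j).

Definition selfadjoint_matrix_operator n (T : 'I_n -> 'I_n -> H -> H) : Prop :=
  forall xi eta, inner_power (matrix_operator T xi) eta =
                 inner_power xi (matrix_operator T eta).

(* Over the reals, selfadjointness is not implied by the second condition. *)
Definition positive_matrix_operator n (T : 'I_n -> 'I_n -> H -> H) : Prop :=
  selfadjoint_matrix_operator T /\
  forall xi, 0 <= inner_power (matrix_operator T xi) xi.

End Hilbert.

Arguments inner {K theta} h.
Arguments Hilbert {K theta hilbert_space inner}.

Section OperatorSystem.
Variables (K : numFieldType) (theta : {rmorphism K -> K}).

(* [(V, star, unit, pos)] is, through [pi], a unital selfadjoint subspace of
   B(H) with the matrix cones of B(H), where M_n(B(H)) = B(H^n). *)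
Record representation (V : lmodType K) (star : V -> V) (unit : V)
    (pos : forall n, 'M[V]_n -> Prop) (H : hilbert theta)
    (pi : V -> H -> H) : Prop := Representation {
  rep_bounded : forall v, bounded_operator (pi v);
  rep_linear : forall (a : K) u v xi,
    pi (a *: u + v) xi = a *: pi u xi + pi v xi;
  rep_injective : forall v, (forall xi, pi v xi = 0) -> v = 0;
  rep_unit : forall xi, pi unit xi = xi;
  rep_star : forall v, adjoint_operators (pi v) (pi (star v));
  rep_pos : forall n (x : 'M[V]_n),
    pos n x <-> positive_matrix_operator (fun i j => pi (x i j))
}.

Definition representable (V : lmodType K) (star : V -> V) (unit : V)
    (pos : forall n, 'M[V]_n -> Prop) : Prop :=
  exists (H : hilbert theta) (pi : V -> H -> H), representation star unit pos pi.

Record opsys := OpSys {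
  opsys_space :> lmodType K;
  star : opsys_space -> opsys_space;
  unit : opsys_space;
  pos : forall n, 'M[opsys_space]_n -> Prop;
  opsys_representable : representable star unit pos
}.

Definition adjoint_mx (V : opsys) n (x : 'M[V]_n) : 'M[V]_n :=
  \matrix_(i, j) star (x j i).

Record ucp (V W : opsys) (f : V -> W) : Prop := Ucp {
  ucp_linear : linear f;
  ucp_unit : f (unit V) = unit W;
  ucp_star : forall x, f (star x) = star (f x);
  ucp_pos : forall n (x : 'M[V]_n), pos x -> pos (map_mx f x)
}.

(* With [ucp f], bijectivity and the last condition, the inverse is ucp too. *)
Definition complete_order_isomorphism (V W : opsys) (f : V -> W) : Prop :=
  [/\ bijective f, ucp f & forall n (x : 'M[V]_n), pos (map_mx f x) -> pos x].

Record kernel (V : opsys) := Kernel {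
  kernel_pred :> {pred V};
  kernelP : exists (W : opsys) (f : V -> W),
    ucp f /\ forall x, (x \in kernel_pred) = (f x == 0)
}.

End OperatorSystem.

Section OpsysTheory.
Variables (K : numFieldType) (theta : {rmorphism K -> K}).

Section Inner.
Variable H : hilbert theta.
Implicit Types x y z : H.

Fact innerC x y : inner H x y = theta (inner H y x).
Proof. by rewrite (hermC (inner H)) expr0 mul1r. Qed.

Fact innerDl x y z : inner H (x + y) z = inner H x z + inner H y z.
Proof. exact: (linearDl (inner H)). Qed.

Fact innerBl x y z : inner H (x - y) z = inner H x z - inner H y z.
Proof. exact: (linearBl (inner H)). Qed.

Fact innerDr x y z : inner H z (x + y) = inner H z x + inner H z y.
Proof. exact: (linearDr (inner H)). Qed.

Fact innerBr x y z : inner H z (x - y) = inner H z x - inner H z y.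
Proof. exact: (linearBr (inner H)). Qed.

Fact inner0l z : inner H 0 z = 0.
Proof. exact: (linear0l (inner H)). Qed.

Fact inner0r z : inner H z 0 = 0.
Proof. exact: (linear0r (inner H)). Qed.

Fact innerZl a x z : inner H (a *: x) z = a * inner H x z.
Proof. exact: (linearZl_LR (inner H)). Qed.

Fact innerZr a x z : inner H z (a *: x) = theta a * inner H z x.
Proof. exact: (linearZr_LR (inner H)). Qed.

Fact inner_suml (I : finType) (F : I -> H) z :
  inner H (\sum_i F i) z = \sum_i inner H (F i) z.
Proof. exact: (linear_sumlz (inner H)). Qed.

Fact inner_sumr (I : finType) (F : I -> H) z :
  inner H z (\sum_i F i) = \sum_i inner H z (F i).
Proof. exact: (linear_sumr (inner H)). Qed.

Fact inner_ge0 x : 0 <= inner H x x.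
Proof.
have [->|x0] := eqVneq x 0; first by rewrite inner0l.
exact/ltW/(neq0_dnorm_gt0 (s := inner H)).
Qed.

Fact inner_eq0 x :
  (forall z, inner H z x = 0) -> x = 0.
Proof.
move=> xy; apply/eqP; apply/negPn/negP => d0.
by have := neq0_dnorm_gt0 (s := inner H) x d0; rewrite xy ltxx.
Qed.

End Inner.

Fact repB (V : lmodType K) (star : V -> V) e
    (pos : forall n, 'M[V]_n -> Prop) (H : hilbert theta) (pi : V -> H -> H) :
  representation star e pos pi ->
  forall u v xi, pi (u - v) xi = pi u xi - pi v xi.
Proof.
by move=> r u v xi; rewrite addrC -scaleN1r (rep_linear r) scaleN1r addrC.
Qed.

Fact rep_selfadjoint (V : lmodType K) (star : V -> V) e
    (pos : forall n, 'M[V]_n -> Prop) (H : hilbert theta) (pi : V -> H -> H) :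
  representation star e pos pi ->
  forall n (x : 'M[V]_n),
    selfadjoint_matrix_operator (fun i j => pi (x i j)) <->
    forall i j, x i j = star (x j i).
Proof.
move=> r n x; split=> [sa|xE xi eta].
  move=> i j; apply/eqP; rewrite -subr_eq0; apply/eqP.
  apply: (rep_injective r) => b; apply: inner_eq0 => a.
  pose d k (c : H) (l : 'I_n) := if l == k then c else 0.
  have pi0 v : pi v 0 = 0.
    have [lp _] := rep_bounded r v.
    by have := lp (-1) 0 0; rewrite scaler0 addr0 scaleN1r addNr.
  have dE k c i' : matrix_operator (fun i j => pi (x i j)) (d k c) i' = pi (x i' k) c.
    rewrite /matrix_operator (bigD1 k) //= {1}/d eqxx big1 ?addr0 // => l lk.
    by rewrite /d (negbTE lk) pi0.
  have /eqP := sa (d i a) (d j b); rewrite /inner_power (bigD1 j) //= big1; last first.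
    by move=> l lk; rewrite /d (negbTE lk) inner0r.
  rewrite (bigD1 i) //= [in X in _ == _ + X]big1; last first.
    by move=> l lk; rewrite {1}/d (negbTE lk) inner0l.
  rewrite !dE /d !eqxx !addr0 (rep_star r) => /eqP h.
  by rewrite (repB r) innerBr h subrr.
rewrite /inner_power /matrix_operator.
under eq_bigr do rewrite inner_suml.
rewrite exchange_big /=; apply: eq_bigr => j _.
rewrite inner_sumr; apply: eq_bigr => i _.
by rewrite (rep_star r) -xE.
Qed.

Fact starB (V : opsys theta) (x y : V) : star (x - y) = star x - star y.
Proof.
case: V x y => V st e P [H [pi r]] /= x y.
have piB := repB r.
apply/eqP; rewrite -subr_eq0; apply/eqP; apply: (rep_injective r) => xi.
apply: inner_eq0 => z.
by rewrite !piB !innerBr -!(rep_star r) piB innerBl subrr.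
Qed.

Fact star0 (V : opsys theta) : star (0 : V) = 0.
Proof. by have := starB (0 : V) 0; rewrite !subrr. Qed.

Fact starN (V : opsys theta) (x : V) : star (- x) = - star x.
Proof. by rewrite -sub0r starB star0 sub0r. Qed.

End OpsysTheory.

Arguments OpSys {K theta opsys_space star unit pos}.
Arguments unit {K theta} o.
Arguments pos {K theta o n}.
Arguments star {K theta o}.

Definition real_conj (R : realType) : {rmorphism R -> R} := idfun.
Definition complex_conj (R : realType) : {rmorphism R[i] -> R[i]} := conjc.

Definition real_opsys (R : realType) := opsys (real_conj R).
Definition complex_opsys (R : realType) := opsys (complex_conj R).

Section KernelTheory.
Variables (K : numFieldType) (theta : {rmorphism K -> K}) (V : opsys theta) (J : kernel V).

Fact kernel_linear_closed :
  [/\ 0 \in kernel_pred J,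
      forall x y, x \in kernel_pred J -> y \in kernel_pred J ->
        x - y \in kernel_pred J &
      forall (a : K) x, x \in kernel_pred J -> a *: x \in kernel_pred J].
Proof.
case: J => P [W [f [[fl _ _ _] kerP]]] /=.
pose f' : {linear V -> W} := HB.pack f (GRing.isLinear.Build K V W *:%R f fl).
have kerP' x : (x \in P) = (f' x == 0) by exact: kerP.
split; first by rewrite kerP' linear0.
- by move=> x y; rewrite !kerP' linearB => /eqP -> /eqP ->; rewrite subr0.
- by move=> a x; rewrite !kerP' linearZ => /eqP -> /=; rewrite scaler0.
Qed.

Fact kernel_zmod_closed : zmod_closed (kernel_pred J).
Proof.
by case: kernel_linear_closed => J0 JB _; split=> // x y; exact: JB.
Qed.

HB.instance Definition _ :=
  GRing.isZmodClosed.Build (opsys_space V) (kernel_pred J) kernel_zmod_closed.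

Definition quotient_space : Type := Quotient.quot (kernel_pred J).

HB.instance Definition _ := GRing.Zmodule.on quotient_space.

Definition quotient_map (x : V) : quotient_space := \pi_(Quotient.quot (kernel_pred J)) x.

Definition quotient_scale (a : K) (q : quotient_space) : quotient_space :=
  quotient_map (a *: repr (q : Quotient.quot (kernel_pred J))).

Fact quotient_mapP x y :
  (quotient_map x == quotient_map y) = (x - y \in kernel_pred J).
Proof. by rewrite Quotient.idealrBE. Qed.

Fact quotient_map_surj q : exists x, quotient_map x = q.
Proof. by exists (repr (q : Quotient.quot (kernel_pred J))); exact: reprK. Qed.

Fact quotient_scaleE a x : quotient_scale a (quotient_map x) = quotient_map (a *: x).
Proof.
apply/eqP; rewrite quotient_mapP -scalerBr.
case: kernel_linear_closed => _ _; apply.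
by rewrite -quotient_mapP; apply/eqP; exact: reprK.
Qed.

Fact quotient_mapD x y : quotient_map (x + y) = quotient_map x + quotient_map y.
Proof. exact: Quotient.pi_add. Qed.

Fact quotient_scaleA a b q :
  quotient_scale a (quotient_scale b q) = quotient_scale (a * b) q.
Proof. by case: (quotient_map_surj q) => x <-; rewrite !quotient_scaleE scalerA. Qed.

Fact quotient_scale1 : left_id 1 quotient_scale.
Proof. by move=> q; case: (quotient_map_surj q) => x <-; rewrite quotient_scaleE scale1r. Qed.

Fact quotient_scaleDr : right_distributive quotient_scale +%R.
Proof.
move=> a p q; case: (quotient_map_surj p) => x <-; case: (quotient_map_surj q) => y <-.
by rewrite -quotient_mapD !quotient_scaleE scalerDr quotient_mapD.
Qed.

Fact quotient_scaleDl q : {morph quotient_scale^~ q : a b / a + b}.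
Proof.
move=> a b; case: (quotient_map_surj q) => x <-.
by rewrite !quotient_scaleE scalerDl quotient_mapD.
Qed.

HB.instance Definition _ := GRing.Zmodule_isLmodule.Build K quotient_space
  quotient_scaleA quotient_scale1 quotient_scaleDr quotient_scaleDl.

Definition quotient_star (q : quotient_space) : quotient_space :=
  quotient_map (star (repr (q : Quotient.quot (kernel_pred J)))).

Fact kernel_star x : x \in kernel_pred J -> star x \in kernel_pred J.
Proof.
case: J => P [W [f [[_ _ fs _] kerP]]] /=; rewrite !kerP fs => /eqP ->.
by rewrite star0.
Qed.

Fact quotient_starE x : quotient_star (quotient_map x) = quotient_map (star x).
Proof.
apply/eqP; rewrite quotient_mapP -starB; apply: kernel_star.
by rewrite -quotient_mapP; apply/eqP; exact: reprK.
Qed.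

Fact quotient_map_eq0 x : x \in kernel_pred J -> quotient_map x = 0.
Proof.
move=> xJ; have -> : 0 = quotient_map 0 by apply: (addrI (quotient_map x)); rewrite -quotient_mapD !addr0.
by apply/eqP; rewrite quotient_mapP subr0.
Qed.

Definition quotient_universal (Q : opsys theta) (q : V -> Q) : Prop :=
  ucp q /\
  forall (W : opsys theta) (f : V -> W),
    ucp f -> (forall x, x \in kernel_pred J -> f x = 0) ->
    exists! g : Q -> W, ucp g /\ forall x, f x = g (q x).

(* A matrix ordering on the vector space [V / J], with unit [e + J], making it
   an operator system with the universal property of the quotient.  Such an
   ordering is unique, so any inhabitant is the quotient operator system. *)
Record quotient := Quotient {
  quotient_pos : forall n, 'M[quotient_space]_n -> Prop;
  quotient_representable :
    representable theta quotient_star (quotient_map (unit V)) quotient_pos;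
  quotient_universalP :
    quotient_universal (Q := OpSys quotient_representable) quotient_map
}.

Definition quotient_opsys (Q : quotient) : opsys theta :=
  OpSys (quotient_representable Q).

Fact quotient_unique (Q1 Q2 : quotient) n (x : 'M[quotient_space]_n) :
  quotient_pos Q1 x <-> quotient_pos Q2 x.
Proof.
suff le (P1 P2 : quotient) : quotient_pos P1 x -> quotient_pos P2 x.
  by split; exact: le.
move=> x0; case: (quotient_universalP P1) => _.
case: (quotient_universalP P2) => q2 _ /(_ (quotient_opsys P2) quotient_map q2).
case=> [y yJ|g [[g_ucp gq] _]].
  exact: quotient_map_eq0.
have := ucp_pos g_ucp x0; congr (quotient_pos P2 _).
apply/matrixP => i j; rewrite mxE.
by case: (quotient_map_surj (x i j)) => y <-; rewrite -gq.
Qed.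

End KernelTheory.

Coercion quotient_opsys : quotient >-> opsys.

(* [V + iV], with [(x, y)] standing for [x + iy]. *)
Definition complexified (V : Type) : Type := (V * V)%type.

Section ComplexifiedSpace.
Variables (R : realType) (V : lmodType R).

HB.instance Definition _ := GRing.Zmodule.on (complexified V).

Definition complexified_scale (c : R[i]) (z : complexified V) : complexified V :=
  (complex.Re c *: z.1 - complex.Im c *: z.2, complex.Re c *: z.2 + complex.Im c *: z.1).

Fact complexified_scaleA a b z :
  complexified_scale a (complexified_scale b z) = complexified_scale (a * b) z.
Proof.
case: a b z => [a1 a2] [b1 b2] [x y]; rewrite /complexified_scale /=.
rewrite !scalerBl !scalerDl !scalerBr !scalerDr !scalerA; congr pair.
  by rewrite -!addrA -!opprD; congr (_ - _); rewrite [RHS]addrC -addrA.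
by rewrite [_ *: x - _]addrC addrACA.
Qed.

Fact complexified_scale1 : left_id 1 complexified_scale.
Proof.
by move=> [x y]; rewrite /complexified_scale /= !scale1r !scale0r subr0 addr0.
Qed.

Fact complexified_scaleDr : right_distributive complexified_scale +%R.
Proof.
move=> a [x y] [x' y']; rewrite /complexified_scale /=.
by congr pair; rewrite !scalerDr ?opprD addrACA.
Qed.

Fact complexified_scaleDl z : {morph complexified_scale^~ z : a b / a + b}.
Proof.
move=> [a1 a2] [b1 b2]; case: z => x y; rewrite /complexified_scale /=.
by congr pair; rewrite !scalerDl ?opprD addrACA.
Qed.

HB.instance Definition _ := GRing.Zmodule_isLmodule.Build R[i] (complexified V)
  complexified_scaleA complexified_scale1 complexified_scaleDr complexified_scaleDl.

End ComplexifiedSpace.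

Section ComplexifiedHilbert.
Variables (R : realType) (H : hilbert (real_conj R)).

Definition complexified_inner (z w : complexified H) : R[i] :=
  (inner H z.1 w.1 + inner H z.2 w.2) +i* (inner H z.2 w.1 - inner H z.1 w.2).

Fact realC (x y : H) : inner H x y = inner H y x.
Proof. exact: innerC. Qed.

Fact realZr a (x y : H) : inner H x (a *: y) = a * inner H x y.
Proof. exact: innerZr. Qed.

Fact complexified_innerBl w : zmod_morphism (complexified_inner^~ w).
Proof.
case: w => w1 w2 [x y] [x' y']; rewrite /complexified_inner /= !innerBl.
by congr Complex; ring.
Qed.

Fact complexified_innerBr z : zmod_morphism (complexified_inner z).
Proof.
case: z => w1 w2 [x y] [x' y']; rewrite /complexified_inner /= !innerBr.
by congr Complex; ring.
Qed.

Fact complexified_innerZl w : scalable_for *%R (complexified_inner^~ w).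
Proof.
case: w => w1 w2 [a b] [x y]; rewrite /complexified_inner /=.
by rewrite !(innerBl, innerDl, innerZl); congr Complex; ring.
Qed.

Fact complexified_innerZr z : scalable_for (conjc \; *%R) (complexified_inner z).
Proof.
case: z => w1 w2 [a b] [x y]; rewrite /complexified_inner /=.
by rewrite !(innerBr, innerDr, innerZr) /=; congr Complex; ring.
Qed.

HB.instance Definition _ := isBilinear.Build R[i] (complexified H) (complexified H)
  R[i] *%R (conjc \; *%R) complexified_inner complexified_innerBl
  complexified_innerBr complexified_innerZl complexified_innerZr.

Fact complexified_inner_herm z w :
  complexified_inner z w = (-1) ^+ false * conjc (complexified_inner w z).
Proof.
rewrite expr0 mul1r /complexified_inner /= opprB.
by rewrite ![inner H w.1 _]realC ![inner H w.2 _]realC.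
Qed.

HB.instance Definition _ := isHermitianSesquilinear.Build R[i] (complexified H)
  false conjc complexified_inner complexified_inner_herm.

Fact complexified_normE z :
  complexified_inner z z = (inner H z.1 z.1 + inner H z.2 z.2)%:C.
Proof. by rewrite /complexified_inner [inner H z.2 z.1]realC subrr. Qed.

Fact complexified_inner_gt0 z : z != 0 -> 0 < complexified_inner z z.
Proof.
case: z => x y z0; rewrite complexified_normE ltcR /=.
have [x0|x0] := eqVneq x 0; last first.
  by rewrite ltr_wpDr ?inner_ge0 //; exact: (neq0_dnorm_gt0 (s := inner H)).
have [y0|y0] := eqVneq y 0; first by rewrite x0 y0 eqxx in z0.
by rewrite ltr_wpDl ?inner_ge0 //; exact: (neq0_dnorm_gt0 (s := inner H)).
Qed.

HB.instance Definition _ := isDotProduct.Build R[i] (complexified H)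
  complexified_inner complexified_inner_gt0.

Fact hilbert_complete : cauchy_complete (inner H).
Proof. by case: (H). Qed.

Fact complexified_complete : cauchy_complete complexified_inner.
Proof.
move=> u u_cauchy.
have ltN (z : complexified H) (e : R) :
  complexified_inner z z < e%:C -> inner H z.1 z.1 < e /\ inner H z.2 z.2 < e.
  rewrite complexified_normE ltcR => lt_e.
  by have := inner_ge0 z.1; have := inner_ge0 z.2; split; lra.
have [|l1 l1P] := @hilbert_complete (fun n => (u n).1).
  move=> e e0; have [|N NP] := u_cauchy e%:C; first by rewrite ltcR.
  by exists N => m n Nm Nn; case: (ltN _ _ (NP m n Nm Nn)).
have [|l2 l2P] := @hilbert_complete (fun n => (u n).2).
  move=> e e0; have [|N NP] := u_cauchy e%:C; first by rewrite ltcR.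
  by exists N => m n Nm Nn; case: (ltN _ _ (NP m n Nm Nn)).
exists (l1, l2) => -[e e']; rewrite ltcE /= => /andP[/eqP -> e0].
have e20 : 0 < e / 2 by rewrite divr_gt0.
have [N1 N1P] := l1P _ e20; have [N2 N2P] := l2P _ e20.
exists (maxn N1 N2) => n; rewrite geq_max => /andP[n1 n2].
rewrite complexified_normE ltcR /=.
by have := N1P n n1; have := N2P n n2; lra.
Qed.

Definition complexified_hilbert : hilbert (complex_conj R) :=
  @Hilbert _ _ (complexified H) (Dot.clone _ _ _ complexified_inner _)
    complexified_complete.

End ComplexifiedHilbert.

Local Ltac gen_ring :=
  repeat match goal with |- context [Dot.sort ?f ?x ?y] =>
    let c := fresh "c" in move: (Dot.sort f x y) => c end; rewrite /=; ring.

Section Complexification.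
Variables (R : realType).

Section Opsys.
Variable V : real_opsys R.

Definition complexified_star (z : complexified V) : complexified V :=
  (star z.1, - star z.2).

Definition complexified_unit : complexified V := (unit V, 0).

Definition complexified_pos n (z : 'M[complexified V]_n) : Prop :=
  let x := map_mx fst z in let y := map_mx snd z in
  [/\ x = adjoint_mx x, y = - adjoint_mx y & pos (block_mx x (- y) y x)].

Variables (H : hilbert (real_conj R)) (pi : V -> H -> H).
Hypothesis r : representation star (unit V) (@pos _ _ V) pi.

Definition complexified_rep (z : complexified V) (w : complexified_hilbert H) :
    complexified_hilbert H :=
  (pi z.1 w.1 - pi z.2 w.2, pi z.1 w.2 + pi z.2 w.1).

Let pi_linear v : linear (pi v).
Proof. by case: (rep_bounded r v). Qed.

Let pi0 v : pi v 0 = 0.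
Proof.
by have := pi_linear v (-1) 0 0; rewrite scaler0 addr0 scaleN1r addNr.
Qed.

Let pi0l w : pi 0 w = 0.
Proof. by rewrite -(subrr 0) (repB r) subrr. Qed.

Let piN v w : pi (- v) w = - pi v w.
Proof. by rewrite -sub0r (repB r) pi0l sub0r. Qed.

Let piD u v w : pi (u + v) w = pi u w + pi v w.
Proof. by have := rep_linear r 1 u v w; rewrite !scale1r. Qed.

Let piZ a v w : pi (a *: v) w = a *: pi v w.
Proof. by have := rep_linear r a v 0 w; rewrite !pi0l !addr0. Qed.

Let pi_rD v x y : pi v (x + y) = pi v x + pi v y.
Proof. by have := pi_linear v 1 x y; rewrite !scale1r. Qed.

Let pi_rZ v a x : pi v (a *: x) = a *: pi v x.
Proof. by have := pi_linear v a x 0; rewrite !pi0 !addr0. Qed.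

Let pi_rN v x : pi v (- x) = - pi v x.
Proof. by rewrite -!scaleN1r pi_rZ. Qed.

Let inner_ext (x y : H) : (forall z, inner H z x = inner H z y) -> x = y.
Proof.
move=> xy; apply/eqP; rewrite -subr_eq0; apply/eqP; apply: inner_eq0 => z.
by rewrite innerBr xy subrr.
Qed.

Let innerN (x y : H) : inner H x (- y) = - inner H x y.
Proof. by rewrite -[- y]sub0r innerBr inner0r sub0r. Qed.

Fact complexified_rep_linear_arg z : linear (complexified_rep z).
Proof.
case: z => x y [a b] [u1 u2] [v1 v2]; rewrite /complexified_rep /=.
by congr pair; apply: inner_ext => t;
  rewrite !(pi_rD, pi_rN, pi_rZ) !(innerDr, innerN, realZr); gen_ring.
Qed.

Fact complexified_rep_linear (a : R[i]) (u v : complexified V) w :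
  complexified_rep (a *: u + v) w =
  a *: complexified_rep u w + complexified_rep v w.
Proof.
case: a u v w => a b [u1 u2] [v1 v2] [w1 w2]; rewrite /complexified_rep /=.
by congr pair; apply: inner_ext => t;
  rewrite !(piD, piN, piZ) !(innerDr, innerN, realZr); gen_ring.
Qed.

Fact complexified_rep_bounded z : bounded_operator (complexified_rep z).
Proof.
split; first exact: complexified_rep_linear_arg.
case: z => x y.
have [_ [M1 M1P]] := rep_bounded r x; have [_ [M2 M2P]] := rep_bounded r y.
exists (2 * (M1 + M2))%:C => -[w1 w2] /=; rewrite !complexified_normE /=.
rewrite -rmorphM lecR /=.
have par (a b : H) : inner H (a + b) (a + b) + inner H (a - b) (a - b) =
    2 * (inner H a a + inner H b b).
  by rewrite !(innerBl, innerBr, innerDl, innerDr); gen_ring.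
have := par (pi x w1) (pi y w2); have := par (pi x w2) (pi y w1).
have := inner_ge0 (pi x w1 + pi y w2); have := inner_ge0 (pi x w2 - pi y w1).
have := M1P w1; have := M1P w2; have := M2P w1; have := M2P w2.
move: (inner H _ _) (inner H _ _) (inner H _ _) (inner H _ _) (inner H _ _) => *.
lra.
Qed.

Fact complexified_rep_injective z : (forall w, complexified_rep z w = 0) -> z = 0.
Proof.
case: z => x y z0; congr pair; apply: (rep_injective r) => w.
  by have [+ _] := z0 (w, 0); rewrite /= pi0 subr0.
by have [_ +] := z0 (w, 0); rewrite /= pi0 add0r.
Qed.

Fact complexified_rep_unit w : complexified_rep complexified_unit w = w.
Proof.
by case: w => w1 w2; rewrite /complexified_rep /= !pi0l !(rep_unit r) subr0 addr0.
Qed.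

Fact complexified_rep_star z :
  adjoint_operators (complexified_rep z) (complexified_rep (complexified_star z)).
Proof.
case: z => x y [a b] [c d]; rewrite /complexified_rep /= /complexified_inner /=.
rewrite !piN !(innerBl, innerBr, innerDl, innerDr, innerN) !(rep_star r).
by congr Complex; gen_ring.
Qed.

Let inner_power_split n (z : 'M[complexified V]_n)
    (xi : 'I_n -> complexified_hilbert H) :
  let x := map_mx fst z in let y := map_mx snd z in
  let b := block_mx x (- y) y x in
  let zeta k := match split k with inl i => (xi i).1 | inr i => (xi i).2 end in
  complex.Re (inner_power
    (matrix_operator (fun i j => complexified_rep (z i j)) xi) xi) =
  inner_power (matrix_operator (fun i j => pi (b i j)) zeta) zeta.
Proof.
move=> x y b zeta.
have zl i : zeta (lshift n i) = (xi i).1 by rewrite /zeta (unsplitK (inl _ i)).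
have zr i : zeta (rshift n i) = (xi i).2 by rewrite /zeta (unsplitK (inr _ i)).
rewrite /inner_power big_split_ord /= -big_split /=.
rewrite (big_morph (@complex.Re R) (id1 := 0) (op1 := +%R)) //; last first.
  by move=> [? ?] [? ?].
apply: eq_bigr => i _; rewrite zl zr /=.
congr (inner H _ _ + inner H _ _); rewrite /matrix_operator big_split_ord /=.
  rewrite (big_morph (@fst H H) (id1 := 0) (op1 := +%R)) // -big_split /=.
  apply: eq_bigr => j _.
  by rewrite zl zr /b block_mxEul block_mxEur !mxE piN.
rewrite (big_morph (@snd H H) (id1 := 0) (op1 := +%R)) // -big_split /=.
apply: eq_bigr => j _.
by rewrite zl zr /b block_mxEdl block_mxEdr !mxE addrC.
Qed.

Fact complexified_selfadjoint n (z : 'M[complexified V]_n) :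
  (forall i j, z i j = complexified_star (z j i)) <->
  (map_mx fst z = adjoint_mx (map_mx fst z) /\
   map_mx snd z = - adjoint_mx (map_mx snd z)).
Proof.
split=> [zE|[/matrixP x /matrixP y] i j].
  by split; apply/matrixP => i j; rewrite !mxE {1}zE.
by have := x i j; have := y i j; rewrite !mxE; case: (z i j) => ? ? /= -> ->.
Qed.

Fact complexified_representation0 :
  representation complexified_star complexified_unit
    (fun n (z : 'M[complexified V]_n) =>
       positive_matrix_operator (fun i j => complexified_rep (z i j)))
    complexified_rep.
Proof.
split=> //.
- exact: complexified_rep_bounded.
- exact: complexified_rep_linear.
- exact: complexified_rep_injective.
- exact: complexified_rep_unit.
- exact: complexified_rep_star.
Qed.

Fact complexified_representation :
  representation complexified_star complexified_unit complexified_pos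
    complexified_rep.
Proof.
have r0 := complexified_representation0.
split; try by case: r0.
move=> n z; rewrite /positive_matrix_operator (rep_selfadjoint r0).
rewrite complexified_selfadjoint /complexified_pos /=.
set x := map_mx fst z; set y := map_mx snd z; set b := block_mx _ _ _ _.
have split_inv (xi : 'I_(n + n) -> H) :
    exists w : 'I_n -> complexified_hilbert H, forall k,
      xi k = match split k with inl i => (w i).1 | inr i => (w i).2 end.
  exists (fun i => (xi (lshift n i), xi (rshift n i))) => k.
  by rewrite -[in LHS](splitK k); case: (split k).
split=> [[xE yE /(rep_pos r) [_ b_ge0]]|[[xE yE] z_ge0]].
  split=> // xi.
  have sa := (rep_selfadjoint r0 z).2 ((complexified_selfadjoint z).2 (conj xE yE)).
  have ge0 := b_ge0 (fun k => match split k with inl i => (xi i).1 | inr i => (xi i).2 end).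
  have := sa xi xi; set c := inner_power _ _ => cE.
  have cR : c = conjc c.
    rewrite {1}cE /c /inner_power rmorph_sum; apply: eq_bigr => i _.
    exact: innerC.
  rewrite lecE /= inner_power_split ge0 andbT.
  move: cR; case: c {cE} => u v [] /= /eqP; rewrite -addr_eq0 -mulr2n.
  by rewrite mulrn_eq0.
split=> //; apply/(rep_pos r); split.
  apply/(rep_selfadjoint r) => i j.
  rewrite -(splitK i) -(splitK j); case: (split i) => i'; case: (split j) => j' /=.
  - by rewrite !block_mxEul {1}xE !mxE.
  - by rewrite block_mxEur block_mxEdl {1}yE !mxE opprK.
  - by rewrite block_mxEur block_mxEdl {1}yE !mxE starN.
  - by rewrite !block_mxEdr {1}xE !mxE.
move=> xi; have [w wE] := split_inv xi.
have := z_ge0 w; rewrite lecE => /andP[_]; rewrite inner_power_split.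
congr (0 <= _); apply: eq_bigr => i _; rewrite -wE; congr (inner H _ _).
by apply: eq_bigr => j _; rewrite -wE.
Qed.

End Opsys.

Fact complexified_representable (V : real_opsys R) :
  representable (complex_conj R) (@complexified_star V) (complexified_unit V)
    (@complexified_pos V).
Proof.
case: (opsys_representable V) => H [pi r].
by exists (complexified_hilbert H), (complexified_rep pi);
  exact: complexified_representation.
Qed.

Definition complexification (V : real_opsys R) : complex_opsys R :=
  OpSys (complexified_representable V).

Definition complexified_map (V W : Type) (f : V -> W) (z : complexified V) :
    complexified W :=
  (f z.1, f z.2).

Fact complexified_map_ucp (V W : real_opsys R) (f : V -> W) : ucp f ->
  @ucp _ _ (complexification V) (complexification W) (complexified_map f).
Proof.
move=> [fl f1 fs fp].
pose f' : {linear V -> W} := HB.pack f (GRing.isLinear.Build R V W *:%R f fl).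
have f0 : f 0 = 0 by exact: (linear0 f').
have fN x : f (- x) = - f x by exact: (linearN f').
have fD x y : f (x + y) = f x + f y by exact: (linearD f').
have fZ a x : f (a *: x) = a *: f x by exact: (linearZ_LR f').
split.
- move=> [a b] [x y] [x' y']; rewrite /complexified_map /=.
  by congr pair; rewrite !(fD, fN, fZ).
- by rewrite /complexified_map /= f0 f1.
- by move=> [x y]; rewrite /complexified_map /= fN !fs.
move=> n z [/matrixP xE /matrixP yE zp]; split.
- by apply/matrixP => i j; have := xE i j; rewrite !mxE /= => ->; rewrite fs.
- by apply/matrixP => i j; have := yE i j; rewrite !mxE /= => ->; rewrite fN fs.
have := fp _ _ zp; rewrite map_block_mx; congr (pos (block_mx _ _ _ _));
  by apply/matrixP => i j; rewrite !mxE ?fN.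
Qed.

Definition complexified_pred (V : real_opsys R) (J : kernel V) :
    {pred complexification V} :=
  fun z => (z.1 \in kernel_pred J) && (z.2 \in kernel_pred J).

Fact complexified_kernelP (V : real_opsys R) (J : kernel V) :
  exists (W : complex_opsys R) (f : complexification V -> W),
    ucp f /\ forall z, (z \in complexified_pred J) = (f z == 0).
Proof.
case: (kernelP J) => W [f [f_ucp fP]].
exists (complexification W), (complexified_map f).
split; first exact: complexified_map_ucp.
by move=> [x y]; rewrite unfold_in /complexified_pred /= !fP.
Qed.

Definition complexified_kernel (V : real_opsys R) (J : kernel V) :
    kernel (complexification V) :=
  Kernel (complexified_kernelP J).

End Complexification.

(* Main.v *)
(** Both maps come from universal properties. The complexification of
    [V -> V/J] is ucp and kills [J_c], hence factors as
    [g : V_c/J_c -> (V/J)_c]. In the other direction, regard [V_c/J_c] as a real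
    operator system by restricting scalars (on the Hilbert space, take the real
    part of the inner product): [x |-> (x + i0) + J_c] is then a real ucp map
    killing [J], hence factors through some [h] on [V/J], and
    [f (p + iq) = h p + i h q] inverts [g].  Complete positivity of [f] follows
    from that of [h] because [a + ib] is positive as soon as
    [[a, -b], [b, a]] is. *)
From HB Require Import structures.
Require Import Defs.
From mathcomp Require Import all_boot all_order all_algebra.
From mathcomp Require Import reals complex.
From mathcomp Require Import ring.

Set Implicit Arguments.
Unset Strict Implicit.
Unset Printing Implicit Defensive.

Import Order.TTheory GRing.Theory Num.Theory.
Local Open Scope ring_scope.
Local Open Scope complex_scope.

(** * Restriction of scalars: complex operator systems as real ones *)

Definition realified (T : Type) : Type := T.

Section RealifiedSpace.
Variables (R : realType) (V : lmodType R[i]).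

HB.instance Definition _ := GRing.Zmodule.on (realified V).

Definition realified_scale (a : R) (v : realified V) : realified V :=
  a%:C *: (v : V).

Lemma realified_scaleA a b v :
  realified_scale a (realified_scale b v) = realified_scale (a * b) v.
Proof. by rewrite /realified_scale scalerA rmorphM. Qed.

Lemma realified_scale1 : left_id 1 realified_scale.
Proof. exact: scale1r. Qed.

Lemma realified_scaleDr : right_distributive realified_scale +%R.
Proof. by move=> a; exact: scalerDr. Qed.

Lemma realified_scaleDl v : {morph realified_scale^~ v : a b / a + b}.
Proof. by move=> a b; rewrite /realified_scale rmorphD scalerDl. Qed.

HB.instance Definition _ := GRing.Zmodule_isLmodule.Build R (realified V)
  realified_scaleA realified_scale1 realified_scaleDr realified_scaleDl.

End RealifiedSpace.

Section RealifiedHilbert.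
Variables (R : realType) (H : hilbert (complex_conj R)).

Definition realified_inner (x y : realified H) : R := complex.Re (inner H x y).

Lemma realified_innerBl y : zmod_morphism (realified_inner^~ y).
Proof. by move=> x x'; rewrite /realified_inner innerBl raddfB. Qed.

Lemma realified_innerBr x : zmod_morphism (realified_inner x).
Proof. by move=> y y'; rewrite /realified_inner innerBr raddfB. Qed.

Lemma realified_innerZl y : scalable_for *%R (realified_inner^~ y).
Proof.
move=> a x; rewrite /realified_inner innerZl.
by case: (inner H x y) => u v /=; rewrite mul0r subr0.
Qed.

Lemma realified_innerZr x : scalable_for (real_conj R \; *%R) (realified_inner x).
Proof.
move=> a y; rewrite /realified_inner innerZr.
by case: (inner H x y) => u v /=; rewrite oppr0 mul0r subr0.
Qed.

HB.instance Definition _ := isBilinear.Build R (realified H) (realified H)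
  R *%R (real_conj R \; *%R) realified_inner realified_innerBl
  realified_innerBr realified_innerZl realified_innerZr.

Lemma realified_inner_herm x y :
  realified_inner x y = (-1) ^+ false * real_conj R (realified_inner y x).
Proof.
rewrite expr0 mul1r /realified_inner /= innerC /=.
by case: (inner H y x).
Qed.

HB.instance Definition _ := isHermitianSesquilinear.Build R (realified H)
  false (real_conj R) realified_inner realified_inner_herm.

(** Positivity in [R[i]] forces the imaginary part of [inner H x x] to vanish, so both inner
    products give the same norm; definiteness, completeness and operator bounds thus transfer. *)
Lemma realified_normE (x : H) : inner H x x = (realified_inner x x)%:C.
Proof.
rewrite /realified_inner; have := inner_ge0 x; rewrite lecE /= => /andP[/eqP].
by case: (inner H x x) => u v /= ->.
Qed.

Lemma realified_inner_gt0 (x : realified H) : x != 0 -> 0 < realified_inner x x.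
Proof.
move=> x0; rewrite -ltcR -realified_normE.
exact: (neq0_dnorm_gt0 (s := inner H)).
Qed.

HB.instance Definition _ := isDotProduct.Build R (realified H)
  realified_inner realified_inner_gt0.

Lemma realified_complete : cauchy_complete realified_inner.
Proof.
have H_complete : cauchy_complete (inner H) by case: (H).
move=> u u_cauchy; have [|l lP] := H_complete u.
  move=> [e e']; rewrite ltcE /= => /andP[/eqP -> /u_cauchy[N NP]].
  by exists N => m n Nm Nn; rewrite realified_normE ltcR; exact: NP.
exists l => e e0; have [|N NP] := lP e%:C; first by rewrite ltcR.
by exists N => n Nn; have := NP n Nn; rewrite realified_normE ltcR.
Qed.

Definition realified_hilbert : hilbert (real_conj R) :=
  @Hilbert _ _ (realified H) (Dot.clone _ _ _ realified_inner _)
    realified_complete.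

End RealifiedHilbert.

Section Realification.
Variables (R : realType) (W : complex_opsys R).

(** The operators and the cones stay the same and only the inner product changes. A selfadjoint
    operator has a real quadratic form, so taking real parts loses no information on positivity. *)
Lemma realified_representation (H : hilbert (complex_conj R)) (pi : W -> H -> H) :
  representation star (unit W) (@pos _ _ W) pi ->
  representation (star : realified W -> realified W) (unit W)
    (@pos _ _ W : forall n, 'M[realified W]_n -> Prop)
    (pi : realified W -> realified_hilbert H -> realified_hilbert H).
Proof.
move=> r; pose pir : realified W -> realified_hilbert H -> realified_hilbert H := pi.
rewrite -[X in representation _ _ _ X]/pir.
have re_power n (xi eta : 'I_n -> H) :
    inner_power (H := realified_hilbert H) xi eta = complex.Re (inner_power xi eta).
  by rewrite /inner_power raddf_sum.
(* With the cone of positive operators taken by definition, [rep_pos] is trivial, which makes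
   [rep_selfadjoint] available for [pir] before the cones [pos] are treated. *)
have r0 : representation (star : realified W -> realified W) (unit W)
    (fun n (x : 'M[realified W]_n) =>
       positive_matrix_operator (fun i j => pir (x i j))) pir.
  split=> //; try by case: r.
  - move=> v; have [piv_lin [M MP]] := rep_bounded r v.
    split; first by move=> a; exact: piv_lin.
    exists (complex.Re M) => x; have := MP x; rewrite !realified_normE lecE.
    by case: (M) => a b /= /andP[_]; rewrite mulr0 subr0.
  - by move=> a; exact: (rep_linear r).
  - by move=> v x y; rewrite /= /realified_inner (rep_star r).
split; try by case: r0.
move=> n x; rewrite (rep_pos r).
(* Selfadjointness for either inner product amounts to the same entrywise condition on [x]. *)
have saE := iff_trans (rep_selfadjoint r x) (iff_sym (rep_selfadjoint r0 x)).
split=> -[sa ge0]; split; [exact/saE| |exact/saE|] => xi.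
  by rewrite re_power; have := ge0 xi; rewrite lecE => /andP[].
(* For the converse, selfadjointness makes the form real, so it is nonnegative as soon as its real
   part is. *)
have piC : conjc (inner_power (matrix_operator (fun i j => pi (x i j)) xi) xi) =
    inner_power (matrix_operator (fun i j => pi (x i j)) xi) xi.
  have /saE sa' := sa; rewrite [RHS]sa' /inner_power rmorph_sum.
  by apply: eq_bigr => i _; rewrite [RHS]innerC.
rewrite lecE -re_power; apply/andP; split; last exact: ge0.
move: piC; case: (inner_power _ _) => u v [] /eqP /=.
by rewrite eq_sym -addr_eq0 -mulr2n mulrn_eq0.
Qed.

Lemma realified_representable :
  representable (real_conj R) (star : realified W -> realified W) (unit W)
    (@pos _ _ W : forall n, 'M[realified W]_n -> Prop).
Proof.
case: (opsys_representable W) => H [pi r].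
by exists (realified_hilbert H), pi; exact: realified_representation.
Qed.

Definition realification : real_opsys R := OpSys realified_representable.

End Realification.

(** * Positivity of block matrices *)

Section RepresentationTheory.
Variables (K : numFieldType) (theta : {rmorphism K -> K}).

Section Operators.
Variables (V : lmodType K) (star : V -> V) (e : V).
Variables (pos : forall n, 'M[V]_n -> Prop) (H : hilbert theta) (pi : V -> H -> H).
Hypothesis r : representation star e pos pi.

Lemma rep0 x : pi 0 x = 0.
Proof. by rewrite -(subrr 0) (repB r) subrr. Qed.

Lemma repN v x : pi (- v) x = - pi v x.
Proof. by rewrite -sub0r (repB r) rep0 sub0r. Qed.

Lemma repZr v c x : pi v (c *: x) = c *: pi v x.
Proof.
by have [/scalable_linear -> _] := rep_bounded r v.
Qed.

End Operators.

Variable V : opsys theta.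

Lemma pos_adjoint_mx n (x : 'M[V]_n) : pos x -> x = adjoint_mx x.
Proof.
case: (opsys_representable V) => H [pi r] /(rep_pos r)[/(rep_selfadjoint r) xE _].
by apply/matrixP => i j; rewrite mxE.
Qed.

(** The form of the block matrix on the direct sum of [H^m] and [H^n] is the sum of the two forms
    ([BE]). *)
Lemma pos_block_diag m n (x : 'M[V]_m) (y : 'M[V]_n) :
  pos x -> pos y -> pos (block_mx x 0 0 y).
Proof.
case: (opsys_representable V) => H [pi r].
move=> /(rep_pos r)[x_sa x_ge0] /(rep_pos r)[y_sa y_ge0].
set B := block_mx _ _ _ _.
have Bl xi i : matrix_operator (fun i j => pi (B i j)) xi (lshift n i) =
    matrix_operator (fun i j => pi (x i j)) (xi \o @lshift m n) i.
  rewrite /matrix_operator big_split_ord /= [X in _ + X]big1 => [|j _].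
    by rewrite addr0; apply: eq_bigr => j _; rewrite /B block_mxEul.
  by rewrite /B block_mxEur mxE (rep0 r).
have Br xi i : matrix_operator (fun i j => pi (B i j)) xi (rshift m i) =
    matrix_operator (fun i j => pi (y i j)) (xi \o @rshift m n) i.
  rewrite /matrix_operator big_split_ord /= [X in X + _]big1 => [|j _].
    by rewrite add0r; apply: eq_bigr => j _; rewrite /B block_mxEdr.
  by rewrite /B block_mxEdl mxE (rep0 r).
have BE xi eta : inner_power (matrix_operator (fun i j => pi (B i j)) xi) eta =
    inner_power (matrix_operator (fun i j => pi (x i j)) (xi \o @lshift m n))
      (eta \o @lshift m n) +
    inner_power (matrix_operator (fun i j => pi (y i j)) (xi \o @rshift m n))
      (eta \o @rshift m n).
  rewrite /inner_power big_split_ord; congr (_ + _);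
    by apply: eq_bigr => i _; rewrite ?Bl ?Br.
apply/(rep_pos r); split=> [xi eta|xi]; last by rewrite BE addr_ge0.
rewrite BE x_sa y_sa /inner_power big_split_ord; congr (_ + _);
  by apply: eq_bigr => i _; rewrite ?Bl ?Br.
Qed.

End RepresentationTheory.

(** The block matrix attached to [x + i0] is the diagonal sum of two copies of [x]. This makes the
    inclusion of [V] in its complexification completely positive. *)
Lemma pos_complexified_real (R : realType) (V : real_opsys R) n (x : 'M[V]_n) :
  pos x -> @pos _ _ (complexification V) n (map_mx (fun v => (v, 0)) x).
Proof.
move=> x_pos; have x1E : map_mx fst (map_mx (fun v => (v, 0 : V)) x) = x.
  by apply/matrixP => i j; rewrite !mxE.
have x2E : map_mx snd (map_mx (fun v => (v, 0 : V)) x) = 0.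
  by apply/matrixP => i j; rewrite !mxE.
split; rewrite ?x1E ?x2E.
- exact: pos_adjoint_mx.
- by apply/matrixP => i j; rewrite !mxE star0 oppr0.
- by rewrite oppr0; exact: pos_block_diag.
Qed.

(* The block matrix maps [(xi, -i xi)] to [(S xi, -i S xi)], where
   [S = a + i b]. *)
Lemma pos_block_complex (R : realType) (W : complex_opsys R) n (a b : 'M[W]_n) :
  pos (block_mx a (- b) b a) -> pos (a + map_mx ( *:%R 'i%C) b).
Proof.
case: (opsys_representable W) => H [pi r].
set B := block_mx _ _ _ _; set S := a + _.
pose zeta (xi : 'I_n -> H) k :=
  match split k with inl i => xi i | inr i => - 'i%C *: xi i end.
have zl xi i : zeta xi (lshift n i) = xi i by rewrite /zeta (unsplitK (inl _ i)).
have zr xi i : zeta xi (rshift n i) = - 'i%C *: xi i.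
  by rewrite /zeta (unsplitK (inr _ i)).
have SE i j x : pi (S i j) x = pi (a i j) x + 'i%C *: pi (b i j) x.
  by rewrite !mxE addrC (rep_linear r) addrC.
have BE xi k : matrix_operator (fun i j => pi (B i j)) (zeta xi) k =
    zeta (matrix_operator (fun i j => pi (S i j)) xi) k.
  rewrite -(splitK k); case: (split k) => i /=; rewrite ?zl ?zr /matrix_operator.
    rewrite big_split_ord /= -big_split; apply: eq_bigr => j _ /=.
    by rewrite /B block_mxEul block_mxEur zl zr mxE (repN r) (repZr r) SE scaleNr opprK.
  rewrite big_split_ord /= -big_split scaler_sumr; apply: eq_bigr => j _ /=.
  rewrite /B block_mxEdl block_mxEdr zl zr (repZr r) SE scalerDr scalerA addrC.
  by rewrite mulNr -expr2 sqr_i opprK scale1r.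
(* As [-i] has modulus 1, each half of [zeta xi] contributes one copy of the inner product, whence
   the factor 2. *)
have zetaE xi eta :
    inner_power (zeta xi) (zeta eta) = 2 * inner_power xi eta.
  rewrite /inner_power big_split_ord /= -big_split mulr_sumr.
  apply: eq_bigr => i _ /=; rewrite !zl !zr innerZl innerZr mulrA /=.
  have -> : - 'i%C * conjc (- 'i%C) = 1 :> R[i] by congr Complex; rewrite /=; ring.
  by rewrite mul1r mulr_natl mulr2n.
have BzE xi eta :
  inner_power (matrix_operator (fun i j => pi (B i j)) (zeta xi)) (zeta eta) =
  2 * inner_power (matrix_operator (fun i j => pi (S i j)) xi) eta.
  by rewrite -zetaE; apply: eq_bigr => k _; rewrite BE.
move=> /(rep_pos r)[sa ge0]; apply/(rep_pos r); split=> [xi eta|xi].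
  have n2 : 2 != 0 :> R[i] by rewrite pnatr_eq0.
  apply: (mulfI n2); rewrite -BzE sa -zetaE.
  by apply: eq_bigr => k _; rewrite BE.
by have := ge0 (zeta xi); rewrite BzE pmulr_rge0 // ltr0n.
Qed.


(** * The canonical map and its inverse *)

Theorem proposition7p5 (R : realType) (V : real_opsys R) (J : kernel V)
    (Q : quotient J) (Qc : quotient (complexified_kernel J)) :
  exists f : complexification Q -> Qc,
    (forall x y : V, f (quotient_map J x, quotient_map J y) =
                     quotient_map (complexified_kernel J) (x, y)) /\
    complete_order_isomorphism f.
Proof.
set qc := quotient_map (complexified_kernel J).
have [qc_ucp qc_univ] := quotient_universalP Qc.
have [q_ucp q_univ] := quotient_universalP Q.
have [|g [[g_ucp gE] _]] := qc_univ _ _ (complexified_map_ucp q_ucp).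
  move=> z /andP[z1 z2]; rewrite /complexified_map.
  by rewrite (quotient_map_eq0 z1) (quotient_map_eq0 z2).
have qc_lin := ucp_linear qc_ucp.
(* By complex linearity [qc] is determined by its values on [V], which dictates the formula for [f]
   below. *)
have qcE x y : qc (x, y) = qc (x, 0) + 'i%C *: qc (y, 0).
  rewrite addrC -qc_lin; congr qc.
  by congr pair; rewrite /= ?scale0r ?scale1r ?scaler0 ?subr0 ?add0r ?addr0.
have j_ucp : ucp (V := V) (W := realification Qc) (fun x => qc (x, 0)).
  split.
  - move=> a x y; rewrite -[RHS]qc_lin; congr qc.
    by congr pair; rewrite /= ?scaler0 ?scale0r ?subr0 ?addr0.
  - exact: (ucp_unit qc_ucp).
  - move=> x; rewrite -[RHS](ucp_star qc_ucp); congr qc.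
    by congr pair; rewrite /= star0 oppr0.
  move=> n x /pos_complexified_real x_pos.
  have := ucp_pos qc_ucp x_pos; congr (pos _).
  by apply/matrixP => i j; rewrite !mxE.
have [|h [[h_ucp hE] _]] := q_univ _ _ j_ucp.
  move=> x xJ; apply: quotient_map_eq0.
  by rewrite unfold_in /= xJ; case: (kernel_linear_closed J).
pose f (z : complexification Q) : Qc := (h z.1 : Qc) + 'i%C *: (h z.2 : Qc).
have fE x y : f (quotient_map J x, quotient_map J y) = qc (x, y).
  by rewrite /f /= -!hE -qcE.
(* Quotient maps are surjective, so both cancellations are checked on classes of elements of [V],
   where [gE] and [fE] compute. *)
have gK : cancel g f.
  by move=> p; have [[x y] <-] := quotient_map_surj p; rewrite -gE fE.
have fK : cancel f g.
  move=> [p1 p2]; have [x <-] := quotient_map_surj p1.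
  by have [y <-] := quotient_map_surj p2; rewrite fE -gE.
have hN x : h (- x) = - h x.
  by rewrite -scaleN1r (scalable_linear (ucp_linear h_ucp)); exact: scaleN1r.
exists f; split=> //; split; first by exists g.
  split.
  (* Linearity, unit and star pass from [g] to its inverse [f]; only positivity goes back to [h]. *)
  - by move=> c z w; apply: (can_inj gK); rewrite (ucp_linear g_ucp) !fK.
  - by apply: (can_inj gK); rewrite fK (ucp_unit g_ucp).
  - by move=> z; apply: (can_inj gK); rewrite (ucp_star g_ucp) !fK.
  move=> n z [_ _ z_pos].
  (* Positivity of [z] is that of a real block matrix, to which [h] applies. The cones of
     [realification Qc] are those of [Qc], so [pos_block_complex] turns the image into
     [map_mx f z]. *)
  have := ucp_pos h_ucp z_pos; rewrite map_block_mx.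
  have -> : map_mx h (- map_mx snd z) = - map_mx h (map_mx snd z).
    by apply/matrixP => i j; rewrite !mxE hN.
  move/(pos_block_complex (W := Qc)); congr (pos _).
  by apply/matrixP => i j; rewrite !mxE.
(* Positivity is reflected by [f] because its inverse [g] is completely positive. *)
move=> n z /(ucp_pos g_ucp); congr (pos _).
by apply/matrixP => i j; rewrite !mxE fK.
Qed.
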